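(* The Euler characteristic of a Motzkin path $x$ in the Motzkin lattice $\mathcal{M}_n$ is $$\chi(x)=\|x\|+o'(x)-e(x),$$ where $\|x\|$ is the number of quasi-join-irreducibles in a quasi-join-irreducible decomposition of $x$, $o'(x)$ is the number of horizontal steps of $x$ at odd height different from $1$, and $e(x)$ is the number of horizontal steps of $x$ at even nonzero height.
   Context: The Motzkin lattice $\mathcal{M}_n$ is the set of Motzkin paths of length $n$, i.e. functions $f:\{0,\ldots,n\}\to\mathbb{N}$ with $f(0)=f(n)=0$ and $f(k+1)-f(k)\in\{1,0,-1\}$, ordered by $f\le g$ iff $f(k)\le g(k)$ for all $k$. It is a finite distributive lattice with minimum $\widehat0=H^n$, where $H=(1,0)$ is the horizontal step. A join-irreducible element is an $x\ne\widehat0$ such that $x=u\vee v$ implies $x=u$ or $x=v$. An element $x$ is quasi-join-irreducible if there is a $k$-tuple $(s_1,\ldots,s_k)$, $k\ge1$, of join-irreducibles forming an antichain such that $x=s_1\vee\cdots\vee s_k$ and $s_i\wedge s_{i+1}\ne\widehat0$ for $i=1,\ldots,k-1$. A quasi-join-irreducible decomposition of $x$ is an expression $x=x_1\vee\cdots\vee x_k$ as a join of quasi-join-irreducible elements with $x_i\wedge x_j=\widehat0$ for all $i\ne j$ (for $x=\widehat0$ the empty join, $k=0$, is used). Every $x\in\mathcal{M}_n$ has such a decomposition; the formula is asserted for any of them, with $\|x\|=k$. A valuation on a finite distributive lattice $L$ is a map $\nu:L\to\mathbb{R}$ with $\nu(\widehat0)=0$ and $\nu(x\vee y)+\nu(x\wedge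 y)=\nu(x)+\nu(y)$ for all $x,y$. It is uniquely determined by its values on join-irreducibles, which can be assigned arbitrarily. The Euler characteristic $\chi$ of $L$ is the unique valuation with $\chi(x)=1$ for every join-irreducible $x$. *)

(* Defs.v *)
From HB Require Import structures.
From mathcomp Require Import all_boot all_order all_algebra.
From mathcomp Require Import zify.
From mathcomp Require Import reals.
Set Implicit Arguments.
Unset Strict Implicit.
Unset Printing Implicit Defensive.
Import Order.TTheory GRing.Theory Num.Theory.

Section FiniteDistributiveLattice.
Local Open Scope order_scope.
Context {d : Order.disp_t} {L : finTBDistrLatticeType d}.

Definition join_irreducible (x : L) : Prop :=
  x != \bot /\ forall u v : L, x = u `|` v -> x = u \/ x = v.

(* [k.+1] encodes a tuple length that is at least 1.  Distinct indices must
   carry incomparable elements, so the entries are pairwise distinct. *)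
Definition quasi_join_irreducible (x : L) : Prop :=
  exists (k : nat) (s : 'I_k.+1 -> L),
    [/\ forall i, join_irreducible (s i),
        forall i j, i != j -> s i >< s j,
        x = \join_(i < k.+1) s i
      & forall i j : 'I_k.+1, j = i.+1 :> nat -> s i `&` s j != \bot].

(* The empty tuple decomposes [\bot], and only [\bot]. *)
Definition qji_decomposition (x : L) (k : nat) (s : 'I_k -> L) : Prop :=
  [/\ forall i, quasi_join_irreducible (s i),
      forall i j, i != j -> s i `&` s j = \bot
    & x = \join_(i < k) s i].

Definition is_valuation (R : realType) (nu : L -> R) : Prop :=
  nu \bot = 0%R /\
  forall x y : L, (nu (x `|` y) + nu (x `&` y) = nu x + nu y)%R.

Definition is_euler_characteristic (R : realType) (chi : L -> R) : Prop :=
  is_valuation chi /\ forall x : L, join_irreducible x -> chi x = 1%R.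

Lemma join_prime (j x y : L) : join_irreducible j ->
  (j <= x `|` y) = (j <= x) || (j <= y).
Proof.
move=> [_ jJ]; apply/idP/orP => [jxy | [h|h]]; last 2 first.
- by apply: (le_trans h); rewrite leUl.
- by apply: (le_trans h); rewrite leUr.
have /jJ [e|e] : j = (j `&` x) `|` (j `&` y) by rewrite -meetUr; apply/esym/meet_idPl.
- by left; rewrite e leIr.
- by right; rewrite e leIr.
Qed.

Lemma ltP_ind (P : L -> Prop) :
  (forall x, (forall y, y < x -> P y) -> P x) -> forall x, P x.
Proof.
move=> H x; have [m] := ubnP #|[set y | y < x]|.
elim: m x => // m IH x hx; apply: H => y yx; apply: IH.
apply: leq_trans (ltnSE hx); apply: proper_card; apply/properP; split.
  by apply/subsetP => z; rewrite !inE => /lt_trans; apply.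
by exists y; rewrite !inE // ltxx.
Qed.

Definition jib (x : L) : bool :=
  (x != \bot) &&
  [forall u : L, forall v : L, (x == u `|` v) ==> (x == u) || (x == v)].

Lemma jibP x : reflect (join_irreducible x) (jib x).
Proof.
apply: (iffP andP) => -[x0 H]; split=> //.
  move=> u v /eqP e; have /forallP /(_ v) /implyP /(_ e) /orP := forallP H u.
  by case=> /eqP; [left|right].
apply/forallP => u; apply/forallP => v; apply/implyP => /eqP /H [->|->].
  by rewrite eqxx.
by rewrite eqxx orbT.
Qed.

(* With [euler_characteristic_unique], this justifies treating the predicate as
   a definition of "the" Euler characteristic. *)
Lemma euler_characteristic_exists (R : realType) :
  exists chi : L -> R, is_euler_characteristic chi.
Proof.
suff [w hw] : exists w : L -> R,
    forall x, jib x -> (\sum_(y | jib y && (y <= x)%O) w y = 1)%R.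
  exists (fun x => \sum_(y | jib y && (y <= x)%O) w y)%R; split; last first.
    by move=> x /jibP; apply: hw.
  split.
    apply: big1 => y /andP[/andP[y0 _]].
    by rewrite lex0 (negPf y0).
  have mk x : (\sum_(y | jib y && (y <= x)%O) w y
      = \sum_(y | jib y) (if (y <= x)%O then w y else 0))%R by exact: big_mkcondr.
  move=> x y; rewrite !mk -!big_split /=; apply: eq_bigr => z /jibP zJ.
  rewrite join_prime // lexI.
  by case: (z <= x); case: (z <= y); rewrite ?addr0 ?add0r.
pose F := fix F (m : nat) (x : L) : R :=
  if m is m'.+1 then (1 - \sum_(y | jib y && (y < x)%O) F m' y)%R else 0%R.
pose rk (x : L) := #|[set y | y < x]|.
have rklt x y : y < x -> (rk y < rk x)%N.
  move=> yx; apply: proper_card; apply/properP; split.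
    by apply/subsetP => z; rewrite !inE => /lt_trans; apply.
  by exists y; rewrite !inE // ltxx.
have FE m1 m2 x : (rk x < m1)%N -> (rk x < m2)%N -> F m1 x = F m2 x.
  elim: m1 m2 x => // m1 IH [//|m2] x h1 h2 /=; congr (_ - _)%R.
  apply: eq_bigr => y /andP[_ /rklt yx].
  by apply: IH; [exact: leq_trans yx h1 | exact: leq_trans yx h2].
have Fs m x : F m.+1 x = (1 - \sum_(y | jib y && (y < x)%O) F m y)%R by [].
exists (fun x => F (rk x).+1 x) => x xJ.
transitivity (F (rk x).+1 x + \sum_(y | jib y && (y < x)%O) F (rk x) y)%R;
  last by rewrite Fs subrK.
rewrite (bigD1 x); last by rewrite xJ lexx.
congr (_ + _)%R.
apply: eq_big => [y|y].
  by rewrite lt_neqAle andbAC -andbA.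
move=> /andP[/andP[_ yx] ynx]; apply: FE => //.
by apply: rklt; rewrite lt_neqAle ynx.
Qed.

Lemma euler_characteristic_unique (R : realType) (chi1 chi2 : L -> R) :
  is_euler_characteristic chi1 -> is_euler_characteristic chi2 -> chi1 =1 chi2.
Proof.
move=> [[z1 v1] j1] [[z2 v2] j2]; apply: ltP_ind => x IH.
have [->|x0] := eqVneq x \bot; first by rewrite z1 z2.
have [/jibP xJ|/nandP] := boolP (jib x); first by rewrite j1 // j2.
rewrite x0 /= => -[//|/forallPn [u /forallPn [v]]].
rewrite negb_imply negb_or => /and3P[/eqP e xu xv].
have ux : u < x by rewrite lt_neqAle eq_sym xu e leUl.
have vx : v < x by rewrite lt_neqAle eq_sym xv e leUr.
have wx : u `&` v < x by apply: le_lt_trans ux; rewrite leIl.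
have := v1 u v; have := v2 u v.
rewrite -e (IH u) // (IH v) // (IH (u `&` v)) // => <-.
exact: addIr.
Qed.

End FiniteDistributiveLattice.

(* The [k]-th step of a path joins the points of abscissa [k] and [k.+1]. *)
Definition step_src n (k : 'I_n) : 'I_n.+1 := widen_ord (leqnSn n) k.
Definition step_tgt n (k : 'I_n) : 'I_n.+1 := lift ord0 k.

Definition is_motzkin_path n (f : {ffun 'I_n.+1 -> nat}) : bool :=
  [&& f ord0 == 0, f ord_max == 0 &
      [forall k : 'I_n, ((f (step_tgt k))%:Z - (f (step_src k))%:Z)%R
                          \in [:: 1; 0; -1 : int]%R]].

Record motzkin (n : nat) := Motzkin {
  mheight :> {ffun 'I_n.+1 -> nat};
  _ : is_motzkin_path mheight }.

HB.instance Definition _ n := [isSub of motzkin n for @mheight n].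
HB.instance Definition _ n := [Countable of motzkin n by <:].

Section MotzkinLattice.
Variable n : nat.
Implicit Types x y z : motzkin n.

Lemma motzkinP (f : {ffun 'I_n.+1 -> nat}) :
  reflect [/\ f ord0 = 0, f ord_max = 0 &
     forall k : 'I_n, f (step_tgt k) <= (f (step_src k)).+1 /\
                      f (step_src k) <= (f (step_tgt k)).+1]
    (is_motzkin_path f).
Proof.
apply: (iffP and3P) => -[].
  move=> /eqP f0 /eqP fn /forallP H; split=> // k.
  by move: (H k); rewrite !inE; lia.
move=> f0 fn H; split; [exact/eqP | exact/eqP | apply/forallP => k].
by move: (H k); rewrite !inE; lia.
Qed.

Lemma motzkin_heightP x :
  [/\ x ord0 = 0, x ord_max = 0 &
     forall k : 'I_n, x (step_tgt k) <= (x (step_src k)).+1 /\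
                      x (step_src k) <= (x (step_tgt k)).+1].
Proof. by case: x => f /= /motzkinP. Qed.

Lemma motzkin_bound x (i : 'I_n.+1) : x i < n.+1.
Proof.
have [x0 _ H] := motzkin_heightP x.
suff E : forall m (lt_m : m < n.+1), x (Ordinal lt_m) <= m.
  by case: i => m lt_m; rewrite ltnS (leq_trans (E m lt_m)).
elim=> [|m IH] lt_m; first by rewrite (_ : Ordinal _ = ord0) ?x0 //; apply: val_inj.
pose k : 'I_n := Ordinal (lt_m : m < n).
have [h _] := H k.
have -> : Ordinal lt_m = step_tgt k by apply: val_inj.
apply: leq_trans h _; rewrite ltnS.
by rewrite (_ : step_src k = Ordinal (ltnW lt_m)) //; apply: val_inj.
Qed.

Definition motzkin_code x : {ffun 'I_n.+1 -> 'I_n.+1} := [ffun i => inord (x i)].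
Definition motzkin_decode (g : {ffun 'I_n.+1 -> 'I_n.+1}) : option (motzkin n) :=
  insub [ffun i => val (g i)].

Lemma motzkin_codeK : pcancel motzkin_code motzkin_decode.
Proof.
move=> x; rewrite /motzkin_decode -[RHS](valK x); congr insub.
by apply/ffunP => i; rewrite !ffunE /= inordK // motzkin_bound.
Qed.

HB.instance Definition _ : isFinite (motzkin n) := PCanIsFinite motzkin_codeK.

Definition motzkin_le x y : bool := [forall k, x k <= y k].

Lemma motzkin_meet_subproof x y :
  is_motzkin_path [ffun k => minn (x k) (y k)].
Proof.
have [x0 xn xs] := motzkin_heightP x; have [y0 yn ys] := motzkin_heightP y.
apply/motzkinP; split; rewrite ?ffunE ?x0 ?xn ?min0n // => k.
by rewrite !ffunE; move: (xs k) (ys k); lia.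
Qed.
Definition motzkin_meet x y := Motzkin (motzkin_meet_subproof x y).

Lemma motzkin_join_subproof x y :
  is_motzkin_path [ffun k => maxn (x k) (y k)].
Proof.
have [x0 xn xs] := motzkin_heightP x; have [y0 yn ys] := motzkin_heightP y.
apply/motzkinP; split; rewrite ?ffunE ?x0 ?y0 ?xn ?yn // => k.
by rewrite !ffunE; move: (xs k) (ys k); lia.
Qed.
Definition motzkin_join x y := Motzkin (motzkin_join_subproof x y).

Lemma motzkin_bot_subproof : is_motzkin_path [ffun _ : 'I_n.+1 => 0].
Proof. by apply/motzkinP; split; rewrite ?ffunE // => k; rewrite !ffunE. Qed.
Definition motzkin_bot := Motzkin motzkin_bot_subproof.

Lemma motzkin_top_subproof :
  is_motzkin_path [ffun k : 'I_n.+1 => minn k (n - k)].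
Proof.
apply/motzkinP; split; rewrite ?ffunE /= ?min0n ?subnn ?minn0 // => k.
by rewrite !ffunE /= /bump /=; have := ltn_ord k; lia.
Qed.
Definition motzkin_top := Motzkin motzkin_top_subproof.

Lemma motzkin_eqP x y : (forall k, x k = y k) -> x = y.
Proof. by move=> e; apply: val_inj; apply/ffunP. Qed.

Lemma motzkin_le_def x y : motzkin_le x y = (motzkin_meet x y == x).
Proof.
apply/forallP/eqP => [h | <- k]; last by rewrite ffunE geq_minr.
by apply: motzkin_eqP => k; rewrite ffunE; apply/minn_idPl.
Qed.
Lemma motzkin_meetC : commutative motzkin_meet.
Proof. by move=> x y; apply: motzkin_eqP => k; rewrite !ffunE minnC. Qed.
Lemma motzkin_joinC : commutative motzkin_join.
Proof. by move=> x y; apply: motzkin_eqP => k; rewrite !ffunE maxnC. Qed.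
Lemma motzkin_meetA : associative motzkin_meet.
Proof. by move=> x y z; apply: motzkin_eqP => k; rewrite !ffunE minnA. Qed.
Lemma motzkin_joinA : associative motzkin_join.
Proof. by move=> x y z; apply: motzkin_eqP => k; rewrite !ffunE maxnA. Qed.
Lemma motzkin_joinKI y x : motzkin_meet x (motzkin_join x y) = x.
Proof. by apply: motzkin_eqP => k; rewrite !ffunE; lia. Qed.
Lemma motzkin_meetKU y x : motzkin_join x (motzkin_meet x y) = x.
Proof. by apply: motzkin_eqP => k; rewrite !ffunE; lia. Qed.
Lemma motzkin_meetUl : left_distributive motzkin_meet motzkin_join.
Proof. by move=> x y z; apply: motzkin_eqP => k; rewrite !ffunE; lia. Qed.
Lemma motzkin_meetxx : idempotent_op motzkin_meet.
Proof. by move=> x; apply: motzkin_eqP => k; rewrite !ffunE minnn. Qed.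

Lemma motzkin_le0x x : motzkin_le motzkin_bot x.
Proof. by apply/forallP => k; rewrite ffunE. Qed.

Lemma motzkin_lex1 x : motzkin_le x motzkin_top.
Proof.
have [x0 xn xs] := motzkin_heightP x.
apply/forallP => k; rewrite ffunE leq_min; apply/andP; split.
  case: k => m; elim: m => [|m IH] lt_m.
    by rewrite (_ : Ordinal _ = ord0) ?x0 //; apply: val_inj.
  pose j : 'I_n := Ordinal (lt_m : m < n); have [h _] := xs j.
  have -> : Ordinal lt_m = step_tgt j by apply: val_inj.
  apply: leq_trans h _; rewrite ltnS.
  by rewrite (_ : step_src j = Ordinal (ltnW lt_m)) ?IH //; apply: val_inj.
have [m] := ubnP (n - k); elim: m k => // m IH k.
have [->|kn] := eqVneq k ord_max; first by rewrite xn.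
have lt_kn : k < n by rewrite ltn_neqAle -ltnS ltn_ord andbT.
move=> hm; have [_] := xs (Ordinal lt_kn).
rewrite (_ : step_src _ = k); last exact: val_inj.
have := IH (step_tgt (Ordinal lt_kn)); rewrite /= /bump /=; lia.
Qed.

End MotzkinLattice.

Fact motzkin_display : Order.disp_t. Proof. exact: Order.Disp tt tt. Qed.

HB.instance Definition _ n :=
  @Order.isMeetJoinDistrLattice.Build motzkin_display (motzkin n)
    (@motzkin_le n) (fun x y => (y != x) && motzkin_le x y)
    (@motzkin_meet n) (@motzkin_join n)
    (@motzkin_le_def n) (fun _ _ => erefl)
    (@motzkin_meetC n) (@motzkin_joinC n) (@motzkin_meetA n) (@motzkin_joinA n)
    (@motzkin_joinKI n) (@motzkin_meetKU n) (@motzkin_meetUl n)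
    (@motzkin_meetxx n).
HB.instance Definition _ n :=
  @Order.hasBottom.Build motzkin_display (motzkin n)
    (motzkin_bot n) (@motzkin_le0x n).
HB.instance Definition _ n :=
  @Order.hasTop.Build motzkin_display (motzkin n)
    (motzkin_top n) (@motzkin_lex1 n).

Definition horizontal_step n (x : motzkin n) (k : 'I_n) : bool :=
  x (step_src k) == x (step_tgt k).

Definition odd_hsteps_neq1 n (x : motzkin n) : nat :=
  #|[set k : 'I_n | [&& horizontal_step x k, odd (x (step_src k))
                        & x (step_src k) != 1]]|.

Definition even_hsteps_neq0 n (x : motzkin n) : nat :=
  #|[set k : 'I_n | [&& horizontal_step x k, ~~ odd (x (step_src k))
                        & x (step_src k) != 0]]|.

(* Main.v *)
(** Writing U, H for up and horizontal steps, the Euler characteristic of [x]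
    counts the U steps leaving height 0, plus the H steps at odd height, minus
    the H steps at nonzero even height.  A sum [\sum_k g (x k) (x k.+1)] over
    steps is modular as soon as
    [g a a.+1 + g a.+1 a = g a a + g a.+1 a.+1] for all [a], because two paths
    whose restrictions to a step are incomparable must cross there as
    [(a, a.+1)] and [(a.+1, a)].  The join-irreducible paths are the pyramids,
    on which this valuation is 1.
    On the other hand, the U steps leaving height 0 together with the H steps
    at height 1 mark the beginnings of the quasi-join-irreducible components:
    their number is additive on disjoint joins (only crossings at [a = 0]
    occur), and it is 1 on a chain of overlapping pyramids. *)
Require Import Defs.
From mathcomp Require Import all_boot all_order all_algebra reals.
From mathcomp Require Import zify.
Import Order.TTheory GRing.Theory.
Local Open Scope ring_scope.

Lemma join_irreducible_le_joins {d : Order.disp_t}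
    {L : finTBDistrLatticeType d} {I : Type} (r : seq I) (F : I -> L) (j : L) :
  join_irreducible j -> (j <= \join_(i <- r) F i)%O -> exists i, (j <= F i)%O.
Proof.
move=> jJ; elim: r => [|i r IH]; first by rewrite big_nil lex0 (negPf jJ.1).
by rewrite big_cons join_prime // => /orP[le_ji|/IH//]; exists i.
Qed.

(** * Pyramids and join-irreducible paths *)

Section Motzkin.
Context {n : nat}.
Implicit Types x y : motzkin n.

Lemma motzkin_joinE x y i : (x `|` y)%O i = maxn (x i) (y i).
Proof. exact: ffunE. Qed.

Lemma motzkin_meetE x y i : (x `&` y)%O i = minn (x i) (y i).
Proof. exact: ffunE. Qed.

Lemma motzkin_botE i : (\bot%O : motzkin n) i = 0%N.
Proof. exact: ffunE. Qed.

Lemma motzkin_leP x y : reflect (forall i, x i <= y i)%N (x <= y)%O.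
Proof. exact: forallP. Qed.

Lemma motzkin_neq0P x : reflect (exists i, 0 < x i)%N (x != \bot%O).
Proof.
apply: (iffP idP) => [x0|[i xi]]; last first.
  by apply: contraTneq xi => ->; rewrite motzkin_botE.
apply/existsP; apply: contraNT x0; rewrite negb_exists => /forallP x0.
by apply/eqP/motzkin_eqP => i; rewrite motzkin_botE; have := x0 i; lia.
Qed.

Lemma motzkin_height_le x i : (x i <= i)%N /\ (x i <= n - i)%N.
Proof.
have /motzkin_leP/(_ i) := lex1 x; rewrite ffunE leq_min.
by move=> /andP.
Qed.

(** [(i - c) + (c - i)] is the distance from [i] to the peak [c]; truncated subtraction keeps the
    path at height 0 beyond the slopes. *)
Definition pyramid_fun (c : 'I_n.+1) (h : nat) : {ffun 'I_n.+1 -> nat} :=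
  [ffun i : 'I_n.+1 => (h - ((i - c) + (c - i)))%N].

Lemma pyramid_subproof x c : is_motzkin_path (pyramid_fun c (x c)).
Proof.
have [h1 h2] := motzkin_height_le x c; have := ltn_ord c => ltc.
apply/motzkinP; split=> [||k]; rewrite !ffunE /= /bump /=; lia.
Qed.

Definition pyramid x c : motzkin n := Motzkin (pyramid_subproof x c).

Lemma pyramidE x c i : pyramid x c i = (x c - ((i - c) + (c - i)))%N.
Proof. exact: ffunE. Qed.

Lemma motzkin_lipschitz x (i j : 'I_n.+1) : (x i <= x j + ((i - j) + (j - i)))%N.
Proof.
have [_ _ xs] := motzkin_heightP x.
suff E m (l l' : 'I_n.+1) : l' = (l + m)%N :> nat ->
    (x l' <= x l + m)%N /\ (x l <= x l' + m)%N.
  case: (leqP i j) => ij.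
    have [//|] := E (j - i)%N i j; lia.
  have [//|] := E (i - j)%N j i; lia.
elim: m l' => [|m IH] l' e.
  by have -> : l' = l; [apply: val_inj; rewrite /= e addn0 | lia].
have lt_m : (l + m < n)%N by have := ltn_ord l'; lia.
have := IH (step_src (Ordinal lt_m)) erefl; have := xs (Ordinal lt_m).
have -> : step_tgt (Ordinal lt_m) = l'.
  by apply: val_inj; rewrite /= /bump /= e; lia.
lia.
Qed.

(** A path lies below the join of the pyramids under its points, so [x], being join-prime, lies
    below one of them; the Lipschitz bound gives the reverse inequality. *)
Lemma join_irreducible_pyramid x :
  join_irreducible x -> exists c, forall i, x i = (x c - ((i - c) + (c - i)))%N.
Proof.
move=> xJ.
have [|c xc] := @join_irreducible_le_joins _ _ _ (enum 'I_n.+1) (pyramid x) x xJ.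
  apply/motzkin_leP => c.
  have /motzkin_leP/(_ c) : (pyramid x c <= \join_(i <- enum 'I_n.+1) pyramid x i)%O.
    by apply: joins_sup_seq => //; rewrite mem_enum.
  by rewrite pyramidE subnn subn0.
exists c => i; have /motzkin_leP/(_ i) := xc; rewrite pyramidE.
have := motzkin_lipschitz x c i; lia.
Qed.

(** * Components and their starts *)

(** In a disjoint join of components, a step (1,1) arises where the step (1,0) ending one component
    is joined with the step (0,1) starting the next. *)
Definition component_start (a b : nat) : bool := (b == 1)%N && (a <= 1)%N.

Definition is_component x : Prop :=
  exists c d : nat, [/\ (c.+1 < d)%N, (d <= n)%N,
    forall i : 'I_n.+1, (0 < x i)%N = (c < i < d)%N
  & forall k : 'I_n, component_start (x (step_src k)) (x (step_tgt k))
                     = (k == c :> nat)].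

Lemma join_irreducible_component x : join_irreducible x -> is_component x.
Proof.
move=> xJ; have [c xE] := join_irreducible_pyramid _ xJ.
have [j xj] := motzkin_neq0P _ xJ.1.
have xc : (0 < x c)%N by move: xj; rewrite xE; lia.
have [h1 h2] := motzkin_height_le x c; have := ltn_ord c => ltc.
exists (c - x c)%N, (c + x c)%N; split=> [||i|k]; try lia.
  by rewrite xE; lia.
rewrite /component_start (xE (step_src k)) (xE (step_tgt k)) /= /bump /=.
by have := ltn_ord k; lia.
Qed.

Lemma join_component x y : is_component x -> is_component y ->
  (x `&` y)%O != \bot%O -> is_component (x `|` y)%O.
Proof.
move=> [a [b [ab bn xpos xstart]]] [c [d [cd dn ypos ystart]]].
wlog le_ac : x y a b c d ab bn cd dn xpos xstart ypos ystart / (a <= c)%N.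
  move=> W; case/orP: (leq_total a c) => [ac|ca].
    exact: (W x y a b c d).
  by rewrite meetC joinC; apply: (W y x c d a b).
move=> /motzkin_neq0P [j]; rewrite motzkin_meetE leq_min xpos ypos.
move=> /andP[/andP[_ jb] /andP[cj _]].
exists a, (maxn b d); split=> [||i|k].
- by rewrite leq_max ab.
- by rewrite geq_max bn.
- rewrite motzkin_joinE leq_max xpos ypos.
  by clear -le_ac jb cj; lia.
rewrite !motzkin_joinE.
have [_ _ /(_ k)[ys _]] := motzkin_heightP y.
move: (xstart k) (ystart k) (xpos (step_src k)) (xpos (step_tgt k))
  (ypos (step_src k)) (ypos (step_tgt k)); rewrite /component_start lift0 /=.
move: (x (step_src k)) (x (step_tgt k)) ys => u u'.
move: (y (step_src k)) (y (step_tgt k)) => v v' ys xs0 ys0 pu pu' pv pv'.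
have [ka|ak|ka] := ltngtP k a.
- have u'0 : u' = 0%N by clear -ka pu'; lia.
  have v'0 : v' = 0%N by clear -ka le_ac pv'; lia.
  by rewrite u'0 v'0.
(* A start of the join at [k] would put [x] back at height 0 at [k.+1] and make [k] the start of
   [y], so [b <= c.+1]; but [j] lies strictly between [c] and [b]. *)
- apply/negP => /andP[/eqP m1 m2].
  have u'0 : u' = 0%N by clear -xs0 m1 m2 ak; lia.
  have kb : (b <= k.+1)%N by clear -pu' u'0 ak; lia.
  have kc : (k == c :> nat) by rewrite -ys0; clear -u'0 m1 m2; lia.
  by clear -kb kc jb cj; lia.
have u0 : u = 0%N by clear -ka pu; lia.
have v0 : v = 0%N by clear -ka le_ac pv; lia.
have u'1 : u' = 1%N by clear -ka xs0; lia.
by move: ys; rewrite u0 v0 u'1; clear; lia.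
Qed.

Lemma quasi_join_irreducible_component x :
  quasi_join_irreducible x -> is_component x.
Proof.
move=> [k [s [sJ _ -> sI]]]; elim: k s sJ sI => [|k IH] s sJ sI.
  by rewrite big_ord_recl big_ord0 joinx0; apply: join_irreducible_component.
rewrite big_ord_recr /=; apply: join_component.
- by apply: IH => [i|i j ij]; [apply: sJ | apply: sI].
- exact: join_irreducible_component.
(* The last entry meets its predecessor, which lies below the join of the earlier ones. *)
have := sI (widen_ord (leqnSn k.+1) ord_max) ord_max erefl.
apply: contra_neq => e; apply/eqP; rewrite -lex0 -e; apply: leI2 => //.
by apply: joins_sup.
Qed.

(** * Modularity of sums over steps *)

Section StepSum.
Context {V : zmodType}.
Implicit Type g : nat -> nat -> V.

Definition step_sum g x : V := \sum_(k < n) g (x (step_src k)) (x (step_tgt k)).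

Definition crossing_modular g (a : nat) : Prop :=
  g a a.+1 + g a.+1 a = g a.+1 a.+1 + g a a.

(** The condition is asked only at heights of the meet, so that for disjoint paths height 0
    suffices. *)
Lemma step_sum_modular g x y :
  (forall i, crossing_modular g ((x `&` y)%O i)) ->
  step_sum g (x `|` y)%O + step_sum g (x `&` y)%O = step_sum g x + step_sum g y.
Proof.
move=> gM; rewrite /step_sum -!big_split /=; apply: eq_bigr => k _.
have [_ _ /(_ k)] := motzkin_heightP x; have [_ _ /(_ k)] := motzkin_heightP y.
have := gM (step_src k); rewrite !motzkin_joinE !motzkin_meetE /crossing_modular.
move: (x (step_src k)) (x (step_tgt k)) (y (step_src k)) (y (step_tgt k)).
move=> a a' b b'; case: (ltngtP a b) => [ab|ab|<-];
  case: (ltngtP a' b') => [ab'|ab'|<-] gab hb ha //; try by rewrite addrC.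
(* Only strict crossings remain; unit steps force the two heights to be consecutive and swapped. *)
- have [-> -> ->] : [/\ b = a.+1, a' = a.+1 & b' = a] by split; lia.
  by rewrite -gab.
- have [-> -> ->] : [/\ a = b.+1, a' = b & b' = b.+1] by split; lia.
  by rewrite -gab addrC.
Qed.

Lemma step_sum_bot g : g 0%N 0%N = 0 -> step_sum g \bot%O = 0.
Proof. by move=> g0; apply: big1 => k _; rewrite !motzkin_botE. Qed.

Lemma step_sum_disjoint_joins g k (s : 'I_k -> motzkin n) :
  g 0%N 0%N = 0 -> crossing_modular g 0 ->
  (forall i j, i != j -> (s i `&` s j)%O = \bot%O) ->
  step_sum g (\join_(i < k) s i)%O = \sum_(i < k) step_sum g (s i).
Proof.
move=> g00 g0; elim: k s => [|k IH] s sD; first by rewrite !big_ord0 step_sum_bot.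
rewrite !big_ord_recr /= -IH => [|i j ij]; last first.
  by apply: sD; apply: contra ij => /eqP/(congr1 val) /= e; apply/eqP/val_inj.
set z := (\join_(i < k) _)%O.
have zD : (z `&` s ord_max)%O = \bot%O.
  rewrite meetC; apply: joins_disjoint => i _.
  by rewrite sD // neq_ltn orbC /= ltn_ord.
rewrite -step_sum_modular => [|i]; last by rewrite zD motzkin_botE.
by rewrite zD step_sum_bot // addr0.
Qed.

End StepSum.

(** * The weights giving the Euler characteristic *)

Section Weights.
Context {R : pzRingType}.

Definition start_weight (a b : nat) : R := (component_start a b)%:R.

(** Height 1 is left out since [start_weight] counts the horizontal steps there. *)
Definition hstep_weight (a b : nat) : R :=
  [&& a == b, odd a & a != 1]%:R - [&& a == b, ~~ odd a & a != 0]%:R.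

Lemma component_start_sum x : is_component x -> step_sum start_weight x = 1.
Proof.
move=> [c [d [cd dn _ xstart]]]; have cn : (c < n)%N by lia.
rewrite /step_sum (bigD1 (Ordinal cn)) //= /start_weight xstart eqxx.
rewrite big1 ?addr0 // => k; rewrite xstart -val_eqE /=.
by move=> /negPf ->.
Qed.

Lemma hstep_sumE x : step_sum hstep_weight x
  = (odd_hsteps_neq1 x)%:R - (even_hsteps_neq0 x)%:R.
Proof.
have cardE (P : pred 'I_n) : #|[set k | P k]|%:R = \sum_k (P k)%:R :> R.
  by rewrite -sum1dep_card natr_sum big_mkcond; apply: eq_bigr => k _; case: P.
by rewrite /step_sum sumrB !cardE.
Qed.

(** The distance to the peak of a pyramid changes by exactly 1 at each step, so horizontal steps
    come only from truncation at 0. *)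
Lemma join_irreducible_hstep_sum x :
  join_irreducible x -> step_sum hstep_weight x = 0.
Proof.
move=> /join_irreducible_pyramid[c xE]; apply: big1 => k _.
rewrite /hstep_weight; case: eqP => [e|_] /=; last by rewrite subrr.
suff -> : x (step_src k) = 0%N by rewrite subrr.
by move: e; rewrite (xE (step_src k)) (xE (step_tgt k)) /= /bump /=; lia.
Qed.

(** The total weight of a horizontal step is 0 at height 0, then alternates 1, -1, 1, and so on.
    Hence both sides are 1 at [a = 0], from (0,1) and (1,1), and both are 0 above. *)
Lemma euler_weight_crossing a :
  crossing_modular (fun a b => start_weight a b + hstep_weight a b) a.
Proof.
rewrite /crossing_modular /start_weight /hstep_weight /component_start.
rewrite (ltn_eqF (ltnSn a)) (gtn_eqF (ltnSn a)) !eqxx /= !subrr !addr0.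
case: a => [|[|a]]; rewrite /= ?negbK.
- by rewrite !subrr !addr0.
- by rewrite !subr0 !add0r addr0 addNr.
by case: (odd a); rewrite /= !add0r subr0 ?subrr ?addNr.
Qed.

End Weights.

Lemma euler_characteristic_step_sum (R : realType) :
  is_euler_characteristic (fun x =>
    step_sum (fun a b => start_weight a b + hstep_weight a b) x : R).
Proof.
split; first split.
- by apply: step_sum_bot; rewrite /hstep_weight subrr addr0.
- by move=> x y; apply: step_sum_modular => i; apply: euler_weight_crossing.
move=> x xJ; rewrite /step_sum big_split /= -/(step_sum start_weight x).
rewrite component_start_sum; last exact: join_irreducible_component.
by rewrite -/(step_sum hstep_weight x) join_irreducible_hstep_sum // addr0.
Qed.

End Motzkin.

Theorem theorem4p7 (R : realType) (n : nat) (chi : motzkin n -> R)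
    (x : motzkin n) (k : nat) (s : 'I_k -> motzkin n) :
  is_euler_characteristic chi ->
  qji_decomposition x s ->
  chi x = k%:R + (odd_hsteps_neq1 x)%:R - (even_hsteps_neq0 x)%:R.
Proof.
move=> chiE [sQ sD xE].
rewrite (euler_characteristic_unique chiE (euler_characteristic_step_sum R)).
rewrite /step_sum big_split /= -/(step_sum start_weight x).
rewrite -/(step_sum hstep_weight x) hstep_sumE addrA; congr (_ + _ - _).
(* Starts add up over the disjoint components, which have one each. *)
rewrite xE step_sum_disjoint_joins //.
rewrite (eq_bigr (fun=> 1)) ?sumr_const ?card_ord // => i _.
exact/component_start_sum/quasi_join_irreducible_component.
Qed.
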